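(* For every $\mu>0$ there exist a nonzero-sum mean-payoff game $\mathcal{G}$ and a strategy $\sigma_0$ of Player 0 such that there exist $\epsilon>0$ and a vertex $v$ of $\mathcal{G}$ with $$\inf_{\sigma_1\in\mathsf{BR}_1^{\epsilon}(\sigma_0)}\underline{\mathsf{MP}}_0(\mathsf{Out}_v(\sigma_0,\sigma_1))<\mathsf{ASV}_{\mathcal{G}}(\sigma_0)(v)-\mu .$$
   Context: An arena $(V,E,\langle V_0,V_1\rangle,w_0,w_1)$ consists of a finite set $V$ of vertices, a set $E\subseteq V\times V$ of edges such that every vertex has at least one successor, a partition of $V$ into $V_0$ (Player 0) and $V_1$ (Player 1), and weight functions $w_0,w_1:E\to\mathbb{Z}$. A (nonzero-sum) mean-payoff game $\mathcal{G}$ is played on such an arena. A play is an infinite path $\pi=\pi_0\pi_1\dots$; a history is a nonempty finite prefix of a play. The payoff of Player $i\in\{0,1\}$ is $\underline{\mathsf{MP}}_i(\pi)=\liminf_{k\to\infty}\frac1k w_i(\pi_0\dots\pi_k)$, where $w_i$ of a history is the sum of the $w_i$-weights of its edges. A strategy of Player $i$ maps each history ending in a vertex of $V_i$ to a successor of that last vertex; $\Sigma_i$ is the set of strategies of Player $i$. $\mathsf{Out}_v(\sigma_0,\sigma_1)$ is the unique play from $v$ consistent with $\sigma_0$ and $\sigma_1$. For $\epsilon>0$, $\mathsf{BR}^{\epsilon}_{1}(\sigma_0)$ is the set of $\sigma_1\in\Sigma_1$ such that for all $v\in V$ and all $\sigma_1'\in\Sigma_1$: $\underline{\mathsf{MP}}_1(\mathsf{Out}_v(\sigma_0,\sigma_1))>\underline{\mathsf{MP}}_1(\mathsf{Out}_v(\sigma_0,\sigma_1'))-\epsilon$.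 The adversarial Stackelberg value of $\sigma_0$ at $v$ is $\mathsf{ASV}_{\mathcal{G}}(\sigma_0)(v)=\sup_{\epsilon>0}\inf_{\sigma_1\in\mathsf{BR}^{\epsilon}_1(\sigma_0)}\underline{\mathsf{MP}}_0(\mathsf{Out}_v(\sigma_0,\sigma_1))$. *)

(* Defs.v *)
From HB Require Import structures.
From mathcomp Require Import all_boot all_order all_algebra.
From mathcomp Require Import all_classical all_reals all_analysis.

Set Implicit Arguments.
Unset Strict Implicit.
Unset Printing Implicit Defensive.

Import Order.TTheory GRing.Theory Num.Theory.

Local Open Scope classical_set_scope.
Local Open Scope ring_scope.

(* The weights are total functions on V x V; only their values on edges
   contribute to the payoff of a play. *)
Record arena := Arena {
  V :> finType;
  E : rel V;
  V0 : {set V};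
  V1 : {set V};
  w0 : V -> V -> int;
  w1 : V -> V -> int;
  has_succ : forall u : V, exists v : V, E u v;
  V0V1_partition : forall v : V, (v \in V1) = (v \notin V0)
}.

Definition is_play (G : arena) (p : nat -> G) : Prop :=
  forall n : nat, E (p n) (p n.+1).

Definition is_history (G : arena) (h : seq G) : Prop :=
  h <> [::] /\ exists2 p : nat -> G, is_play p & h = mkseq p (size h).

(* Strategies of the player owning the set of vertices X. The value of the
   underlying function on sequences other than histories ending in X is
   irrelevant. *)
Record strategy (G : arena) (X : {set G}) := Strategy {
  strategy_fun :> seq G -> G;
  strategy_edge : forall (h : seq G) (v : G),
    is_history (rcons h v) -> v \in X -> E v (strategy_fun (rcons h v))
}.

Definition consistent (G : arena) (X : {set G}) (s : strategy X)
    (p : nat -> G) : Prop :=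
  forall n : nat, p n \in X -> p n.+1 = s (mkseq p n.+1).

Section Outcome.
Variables (G : arena) (s0 : strategy (V0 G)) (s1 : strategy (V1 G)) (v : G).

Fixpoint out_history (n : nat) : seq G :=
  if n is m.+1 then
    let h := out_history m in
    rcons h (if last v h \in V0 G then s0 h else s1 h)
  else [:: v].

(* This is the unique play from v consistent with s0 and s1: see
   OutP and Out_unique. *)
Definition Out (n : nat) : G := last v (out_history n).

Lemma out_historyE (n : nat) : out_history n = mkseq Out n.+1.
Proof.
elim: n => [//|n IHn].
by rewrite mkseqS -IHn /Out /= last_rcons.
Qed.

Lemma OutS (n : nat) :
  Out n.+1 = if Out n \in V0 G then s0 (mkseq Out n.+1)
             else s1 (mkseq Out n.+1).
Proof. by rewrite -out_historyE {1}/Out /= last_rcons. Qed.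

End Outcome.

Lemma is_history_mkseq (G : arena) (p : nat -> G) (n : nat) :
  (forall m, (m < n)%N -> E (p m) (p m.+1)) -> is_history (mkseq p n.+1).
Proof.
move=> pE; split; first by move/(congr1 size); rewrite size_mkseq.
pose nxt (u : G) := xchoose (has_succ u).
pose q k := if (k <= n)%N then p k else iter (k - n) nxt (p n).
exists q => [k|]; last first.
  rewrite size_mkseq; apply/eq_in_map => k.
  by rewrite mem_iota add0n ltnS /q => /andP[_ ->].
rewrite /q; case: (ltngtP k n) => [kn|nk|->]; first exact: pE.
- by rewrite subSn 1?ltnW //=; exact: (xchooseP (has_succ _)).
- by rewrite subSnn; exact: (xchooseP (has_succ _)).
Qed.

Lemma OutP (G : arena) (s0 : strategy (V0 G)) (s1 : strategy (V1 G)) (v : G) :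
  [/\ is_play (Out s0 s1 v), Out s0 s1 v 0%N = v,
      consistent s0 (Out s0 s1 v) & consistent s1 (Out s0 s1 v)].
Proof.
split=> //.
- move=> n; elim/ltn_ind: n => n IHn.
  have := is_history_mkseq IHn; rewrite OutS mkseqS => hH.
  case: ifPn => nV; first exact: strategy_edge.
  by apply: strategy_edge => //; rewrite V0V1_partition.
- by move=> n nV; rewrite OutS nV.
- by move=> n; rewrite V0V1_partition => /negbTE nV; rewrite OutS nV.
Qed.

Lemma Out_unique (G : arena) (s0 : strategy (V0 G)) (s1 : strategy (V1 G))
    (v : G) (p : nat -> G) :
  p 0%N = v -> consistent s0 p -> consistent s1 p -> p = Out s0 s1 v.
Proof.
move=> p0 c0 c1.
suff H n : mkseq p n.+1 = mkseq (Out s0 s1 v) n.+1.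
  apply/funext => n; have /(congr1 (last v)) := H n.
  by rewrite !mkseqS !last_rcons.
elim: n => [|n IHn]; first by rewrite /mkseq /= p0.
rewrite mkseqS IHn [RHS]mkseqS; congr rcons.
have /(congr1 (last v)) := IHn; rewrite !mkseqS !last_rcons => pn.
rewrite OutS -IHn -pn; case: ifPn => nV; first exact: c0.
by apply: c1; rewrite V0V1_partition.
Qed.

Section Values.
Variables (R : realType) (G : arena).

(* At k = 0 the mean is 0, by the convention 0^-1 = 0; this does not affect
   the limit inferior. *)
Definition MP (w : G -> G -> int) (p : nat -> G) : \bar R :=
  limn_einf (fun k : nat =>
    (((\sum_(j < k) w (p j) (p j.+1))%:~R / k%:R : R)%:E)).

Definition MP0 (p : nat -> G) : \bar R := MP (@w0 G) p.
Definition MP1 (p : nat -> G) : \bar R := MP (@w1 G) p.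

Definition BR1 (eps : R) (s0 : strategy (V0 G)) : set (strategy (V1 G)) :=
  [set s1 | forall (v : G) (s1' : strategy (V1 G)),
    (MP1 (Out s0 s1 v) > MP1 (Out s0 s1' v) - eps%:E)%E].

Definition ASV (s0 : strategy (V0 G)) (v : G) : \bar R :=
  ereal_sup [set ereal_inf [set MP0 (Out s0 s1 v) | s1 in BR1 eps s0]
            | eps in [set eps : R | 0 < eps]].

End Values.

(* Main.v *)
(* Every vertex belongs to Player 1, who from the initial vertex [None] chooses
   once and for all between two absorbing vertices: [Some true], with payoffs
   (M, 1), where M > mu, and [Some false], with payoffs (0, 0). For epsilon = 2
   every strategy is an epsilon-best response, so that Player 0 may get 0; for
   epsilon = 1/2 every epsilon-best response moves to [Some true]. *)
Require Import Defs.
From mathcomp Require Import all_boot all_order all_algebra.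
From mathcomp Require Import all_classical all_reals all_analysis.
From mathcomp Require Import lra.

Import Order.TTheory GRing.Theory Num.Theory.

Local Open Scope classical_set_scope.
Local Open Scope ring_scope.

Lemma limn_einf_near_cst (R : realType) (u : (\bar R)^nat) (l : \bar R) :
  (\forall n \near \oo, u n = l) -> limn_einf u = l.
Proof.
move=> ul; have ucvg : u @ \oo --> l by exact: cvg_near_cst.
by rewrite is_cvg_limn_einfE; [exact/cvg_lim|apply/cvg_ex; exists l].
Qed.

Lemma MP_cst (R : realType) (G : arena) (w : G -> G -> int) (p : nat -> G)
    (c : int) :
  (forall n, w (p n) (p n.+1) = c) -> MP R w p = (c%:~R)%:E.
Proof.
(* The threshold is 1 because the mean at [k = 0] is 0 by convention, whatever [c] is. *)
move=> wc; apply: limn_einf_near_cst; exists 1%N => // k /= k_gt0.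
rewrite (eq_bigr (fun=> c)) // sumr_const card_ord rmorphMn /=.
by rewrite -mulr_natr mulfK // pnatr_eq0 -lt0n.
Qed.

Definition choice_edge (u v : option bool) : bool :=
  if u is Some _ then v == u else v != None.

(* Weights are read off the target, so that they are constant along any play. *)
Definition choice_weight (c : int) (_ v : option bool) : int :=
  if v == Some true then c else 0.

Lemma choice_edge_total (u : option bool) : exists v, choice_edge u v.
Proof.
by case: u => [b|]; [exists (Some b); rewrite /= eqxx|exists (Some true)].
Qed.

Lemma choice_partition (v : option bool) :
  (v \in [set: option bool]%SET) = (v \notin finset.set0).
Proof. by rewrite !finset.inE. Qed.

Definition choice_arena (M : int) : arena :=
  @Arena (option bool) choice_edge finset.set0 [set: option bool]%SET
    (choice_weight M) (choice_weight 1) choice_edge_total choice_partition.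

Definition choice_move (b : bool) (h : seq (option bool)) : option bool :=
  if last None h is Some c then Some c else Some b.

Lemma choice_move_edge (b : bool) (h : seq (option bool)) (v : option bool) :
  choice_edge v (choice_move b (rcons h v)).
Proof. by rewrite /choice_move last_rcons; case: v => [c|] /=. Qed.

(** Generic in [X], so that it provides both [s0] and the two strategies of Player 1 to be
    compared. *)
Definition choice_strategy (M : int) (X : {set choice_arena M}) (b : bool) :
    strategy X :=
  @Strategy (choice_arena M) X (choice_move b)
    (fun h v _ _ => choice_move_edge b h v).

(** Every edge ends in some [Some b], whose only successor is itself. Indices start at 1 since the
    play may begin in [None]. *)
Lemma choice_play (M : int) (p : nat -> choice_arena M) :
  is_play p -> exists b, forall n, p n.+1 = Some b.
Proof.
move=> pE; have [b p1] : exists b, p 1%N = Some b.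
  have := pE 0%N; rewrite /E /=.
  by case: (p 0%N) => [c /eqP ->|]; [exists c|case: (p 1%N) => // b; exists b].
exists b; elim=> [//|n IHn]; have := pE n.+1.
by rewrite IHn /E /= => /eqP.
Qed.

Lemma choice_MP0 (R : realType) (M : int) (p : nat -> choice_arena M) (b : bool) :
  (forall n, p n.+1 = Some b) ->
  MP0 R p = (if b then M%:~R else 0)%:E.
Proof.
move=> p_absorbed; rewrite /MP0 (@MP_cst _ _ _ _ (if b then M else 0)); first by case: (b).
by move=> n; rewrite p_absorbed /= /choice_weight; case: (b).
Qed.

Lemma choice_MP1 (R : realType) (M : int) (p : nat -> choice_arena M) (b : bool) :
  (forall n, p n.+1 = Some b) ->
  MP1 R p = (b%:R)%:E.
Proof.
move=> p_absorbed; rewrite /MP1 (@MP_cst _ _ _ _ (b%:R)); first by case: (b).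
by move=> n; rewrite p_absorbed /= /choice_weight; case: (b).
Qed.

Lemma choice_Out (M : int) (s0 : strategy (V0 (choice_arena M)))
    (s1 : strategy (V1 (choice_arena M))) (v : choice_arena M) :
  exists b, forall n, Out s0 s1 v n.+1 = Some b.
Proof. by apply: choice_play; case: (OutP s0 s1 v). Qed.

Lemma choice_strategy_Out (M : int) (s0 : strategy (V0 (choice_arena M)))
    (b : bool) (n : nat) :
  Out s0 (choice_strategy M (V1 (choice_arena M)) b) None n.+1 = Some b.
Proof.
have [c Hc] := choice_Out M s0 (choice_strategy M _ b) None.
(* The absorbing vertex is already visible at time 1, after Player 1's move from [None]. *)
by rewrite Hc -(Hc 0%N) OutS !inE.
Qed.

Theorem proposition3 (R : realType) (mu : R) (mu_gt0 : 0 < mu) :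
  exists (G : arena) (s0 : strategy (V0 G)) (eps : R) (v : G),
    0 < eps /\
    (ereal_inf [set MP0 R (Out s0 s1 v) | s1 in BR1 eps s0]
       < ASV R s0 v - mu%:E)%E.
Proof.
(* Weights are integers, hence an Archimedean bound of [mu]. *)
pose M : int := (Num.bound mu)%:Z.
have mu_lt_M : mu < M%:~R by rewrite -pmulrn archi_boundP // ltW.
pose s0 := choice_strategy M (V0 (choice_arena M)) true.
pose s1 := choice_strategy M (V1 (choice_arena M)).
exists (choice_arena M), s0, 2, None; split; first exact: ltr0n.
have inf_le0 :
    (ereal_inf [set MP0 R (Out s0 s1' None) | s1' in BR1 (2 : R) s0] <= 0)%E.
  apply: ereal_inf_lbound; exists (s1 false).
    move=> v s1'.
    have [b Hb] := choice_Out M s0 (s1 false) v.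
    have [b' Hb'] := choice_Out M s0 s1' v.
    rewrite (choice_MP1 R M _ _ Hb) (choice_MP1 R M _ _ Hb') -EFinB lte_fin.
    (* The tightest case is [0 > 1 - 2]. *)
    by case: (b); case: (b') => /=; lra.
  exact: (choice_MP0 R M _ _ (choice_strategy_Out M s0 false)).
have ASV_geM : ((M%:~R)%:E <= ASV R s0 None)%E.
  (* A supremum over epsilon is bounded below by its term at 1/2. *)
  apply: (@le_trans _ _
    (ereal_inf [set MP0 R (Out s0 s1' None) | s1' in BR1 (2^-1 : R) s0])); last first.
    by apply: ereal_sup_ubound; exists 2^-1 => //=; rewrite invr_gt0.
  apply: le_ereal_inf_tmp => _ [s1' BRs1' <-].
  have [b Hb] := choice_Out M s0 s1' None.
  (* Compared with [s1 true], which earns Player 1 the payoff 1 from [None], a best response needs a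
     payoff above 1/2. This forces [b = true], hence payoff [M] for Player 0. *)
  have /= := BRs1' None (s1 true); rewrite (choice_MP0 R M _ _ Hb).
  rewrite (choice_MP1 R M _ _ Hb).
  rewrite (choice_MP1 R M _ _ (choice_strategy_Out M s0 true)).
  by rewrite -EFinB !lte_fin lee_fin; case: (b) => //=; lra.
apply: (le_lt_trans inf_le0); apply: lt_le_trans (leeB ASV_geM (lexx _)).
by rewrite -EFinB lte_fin subr_gt0.
Qed.
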